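(* Let $q\ge 0$ be an integer, let $\theta_0=1$, $\theta_1,\dots,\theta_q\in\mathbb{R}$, and let $\{e_t\}_{t\in\mathbb{Z}}$ be an i.i.d. sequence with $e_t\sim S^0_\alpha(\beta^{(0)},\gamma^{(0)},\delta^{(0)})$. Let $X_t=\sum_{j=0}^q\theta_j e_{t-j}$ and, for integers $r\ge1$, let $S_t^{(r)}=\sum_{i=0}^{r-1}X_{t-i}$. Let $0<p_1<p_2<1$, and let $\zeta^{(r)}_{p_1,p_2}$ and $\zeta^{(0)}_{p_1,p_2}$ be the log quantile differences at levels $p_1,p_2$ of $S_t^{(r)}$ and of $e_t$, respectively. Suppose that either (A1) $\beta^{(0)}=0$, or (A2) $\sum_{j=0}^{i}\theta_j\ge 0$ for $i=0,\dots,q-1$ and $\sum_{j=i}^{q}\theta_j\ge0$ for $i=1,\dots,q$. Then for every integer $r\ge 1$ with $r\geq q$, $$\zeta^{(r)}_{p_1,p_2}=\alpha^{-1}\ln\Big(r\Big|\sum_{i=0}^{q}\theta_i\Big|^\alpha+g_\alpha(\theta)\Big)+\zeta^{(0)}_{p_1,p_2},$$ where $$g_\alpha(\theta)=\sum_{i=0}^{q-1}\Big|\sum_{j=0}^{i}\theta_j\Big|^\alpha-q\Big|\sum_{i=0}^{q}\theta_i\Big|^\alpha+\sum_{i=1}^{q}\Big|\sum_{j=i}^{q}\theta_j\Big|^\alpha .$$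
   Context: $S^0_\alpha(\beta,\gamma,\delta)$ denotes the stable distribution in Nolan's $S^0$ parameterisation, with stability $\alpha\in(0,2]$, skewness $\beta\in[-1,1]$, scale $\gamma>0$ and location $\delta\in\mathbb{R}$: $Y\sim S^0_\alpha(\beta,\gamma,\delta)$ iff for all $u\in\mathbb{R}$ (value $1$ at $u=0$), $$E e^{iuY}=\exp\big(-\gamma^\alpha|u|^\alpha[1+i\beta\tan(\pi\alpha/2)\operatorname{sign}(u)((\gamma|u|)^{1-\alpha}-1)]+i\delta u\big)\quad\text{if }\alpha\neq1,$$ $$E e^{iuY}=\exp\big(-\gamma|u|[1+i\beta\tfrac{2}{\pi}\operatorname{sign}(u)\ln(\gamma|u|)]+i\delta u\big)\quad\text{if }\alpha=1.$$ For a random variable with $p$th quantile $\xi_p$, the log quantile difference at levels $0<p_1<p_2<1$ is $\zeta_{p_1,p_2}=\ln(\xi_{p_2}-\xi_{p_1})$. It is a standing assumption that random variables for which it is computed have positive density at $\xi_{p_1}$ and $\xi_{p_2}$ (so that these quantiles are unique and $\zeta_{p_1,p_2}$ is finite); stable distributions are known to satisfy this. *)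

(* Defs.v *)
From HB Require Import structures.
From mathcomp Require Import all_boot all_order all_algebra.
From mathcomp Require Import all_classical all_reals all_analysis.
(* Provides the ring structure on measurable functions; all_analysis does not export it. *)
From mathcomp Require Import measurable_realfun.
From mathcomp Require Import complex.

Set Implicit Arguments.
Unset Strict Implicit.
Unset Printing Implicit Defensive.

Import Order.TTheory GRing.Theory Num.Theory.
Import numFieldNormedType.Exports.

Local Open Scope classical_set_scope.
Local Open Scope ring_scope.
Local Open Scope complex_scope.

Definition cexp (R : realType) (z : R[i]) : R[i] :=
  (expR (complex.Re z))%:C * (cos (complex.Im z) +i* sin (complex.Im z)).

Section random_variables.
Context d (T : measurableType d) (R : realType) (P : probability T R).

Definition mutually_independent (I : eqType) (X : I -> {RV P >-> R}) : Prop :=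
  forall s : seq I, uniq s ->
  forall B : I -> set R, (forall i, measurable (B i)) ->
    P (\bigcap_(i in [set` s]) (X i @^-1` B i)) =
    (\prod_(i <- s) P (X i @^-1` B i))%E.

Definition identically_distributed (I : Type) (X : I -> {RV P >-> R}) : Prop :=
  forall (i j : I) (B : set R), measurable B ->
    distribution P (X i) B = distribution P (X j) B.

Definition iid (I : eqType) (X : I -> {RV P >-> R}) : Prop :=
  mutually_independent X /\ identically_distributed X.

Definition charfun (X : {RV P >-> R}) (u : R) : R[i] :=
  fine 'E_P[fun w => cos (u * X w)] +i* fine 'E_P[fun w => sin (u * X w)].

(* Left-continuous inverse of the cdf, for 0 < p < 1. *)
Definition quantile (X : {RV P >-> R}) (p : R) : R :=
  inf [set x : R | (p%:E <= cdf X x)%E].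

Definition log_quantile_diff (X : {RV P >-> R}) (p1 p2 : R) : R :=
  ln (quantile X p2 - quantile X p1).

Definition moving_average (q : nat) (theta : nat -> R)
    (e : int -> {RV P >-> R}) (t : int) : {RV P >-> R} :=
  \sum_(0 <= j < q.+1) theta j *: e (t - j%:Z).

Definition rolling_sum (X : int -> {RV P >-> R}) (r : nat) (t : int) :
    {RV P >-> R} :=
  \sum_(0 <= i < r) X (t - i%:Z).

End random_variables.

(* Characteristic function of the stable law in Nolan's S^0 parameterisation.
   It is meant for 0 < alpha <= 2, -1 <= beta <= 1 and 0 < gamma. *)
Definition stable0_charfun (R : realType) (alpha beta gamma delta u : R) :
    R[i] :=
  if u == 0 then 1
  else if alpha == 1 then
    cexp (- (gamma * `|u|)%:C *
            (1 +i* (beta * (2 / pi) * Num.sg u * ln (gamma * `|u|)))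
          + (0 +i* (delta * u)))
  else
    cexp (- (gamma `^ alpha * `|u| `^ alpha)%:C *
            (1 +i* (beta * tan (pi * alpha / 2) * Num.sg u *
                    ((gamma * `|u|) `^ (1 - alpha) - 1)))
          + (0 +i* (delta * u))).

Definition has_stable0_law d (T : measurableType d) (R : realType)
    (P : probability T R) (X : {RV P >-> R}) (alpha beta gamma delta : R) :
    Prop :=
  forall u : R, charfun X u = stable0_charfun alpha beta gamma delta u.

Definition g_stable (R : realType) (alpha : R) (q : nat) (theta : nat -> R) :
    R :=
  \sum_(0 <= i < q) `|\sum_(0 <= j < i.+1) theta j| `^ alpha
  - q%:R * `|\sum_(0 <= i < q.+1) theta i| `^ alpha
  + \sum_(1 <= i < q.+1) `|\sum_(i <= j < q.+1) theta j| `^ alpha.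

(* Main.v *)
Require Import Defs.
From HB Require Import structures.
From mathcomp Require Import all_boot all_order all_algebra.
From mathcomp Require Import all_classical all_reals all_analysis.
From mathcomp Require Import measurable_realfun.
From mathcomp Require Import complex.
From mathcomp Require Import ring lra zify.

(** For r >= q the rolling sum is S_t = sum_k c_k e_{t-k} over 0 <= k < r + q,
    where the weights c_k are the initial sums of theta for k < q, the full sum
    for q <= k < r, and the final sums for k >= r; hence
    C = sum_k |c_k|^alpha = r |sum_i theta_i|^alpha + g_alpha(theta), and
    C >= |c_0|^alpha = 1.  By independence the characteristic function of S_t is
    prod_k phi(c_k u); since in each case beta = 0 or all c_k >= 0, it is that of
    Y = C^(1/alpha) e_t + m for some constant m.

    Characteristic functions determine the distribution: they determine the mean
    of every trigonometric polynomial, and by bounded convergence that of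
    sgn(sin(h(x - b))), of sgn(x - b) and of the indicators of half-lines.  So
    the quantiles of S_t are those of Y, and the logarithm turns the ratio
    C^(1/alpha) of the quantile differences into the summand ln(C)/alpha.  This
    needs the quantile difference of e_t to be positive (ln 0 = 0 here), which
    holds because a law whose characteristic function vanishes at infinity has
    no atoms. *)

Import Order.TTheory GRing.Theory Num.Theory.
Import numFieldNormedType.Exports.

Local Open Scope classical_set_scope.
Local Open Scope ring_scope.

(** * Bounded measurable functions *)

Section bounded_measurable_functions.
Context {d : measure_display} {T : measurableType d} {R : realType}.
Implicit Types f g : T -> R.

Definition bounded_mfun f :=
  measurable_fun setT f /\ exists M : R, forall x, `|f x| <= M.

Lemma bounded_mfun_cst (c : R) : bounded_mfun (fun=> c).
Proof. by split => //; exists `|c|. Qed.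

Lemma bounded_mfunD {f g} :
  bounded_mfun f -> bounded_mfun g -> bounded_mfun (fun x => f x + g x).
Proof.
move=> [mf [M hM]] [mg [N hN]]; split; first exact: measurable_funD.
by exists (M + N) => x; rewrite (le_trans (ler_normD _ _))// lerD.
Qed.

Lemma bounded_mfunM {f g} :
  bounded_mfun f -> bounded_mfun g -> bounded_mfun (fun x => f x * g x).
Proof.
move=> [mf [M hM]] [mg [N hN]]; split; first exact: measurable_funM.
by exists (M * N) => x; rewrite normrM ler_pM.
Qed.

Lemma bounded_mfunZ (c : R) {f} : bounded_mfun f -> bounded_mfun (fun x => c * f x).
Proof. by move=> hf; apply: bounded_mfunM => //; exact: bounded_mfun_cst. Qed.

Lemma bounded_mfun_indic {A : set T} : measurable A -> bounded_mfun (\1_A : T -> R).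
Proof.
by move=> mA; split => //; exists 1 => x; rewrite indicE normr_nat lern1 leq_b1.
Qed.

Context (P : probability T R).

Lemma bounded_mfun_integrable {f} :
  bounded_mfun f -> P.-integrable setT (EFin \o f).
Proof.
move=> [mf [M hM]]; apply: measurable_bounded_integrable => //.
  by rewrite -ge0_fin_numE// fin_num_measure.
exists M; split; first exact: num_real.
by move=> x Mx y _; apply: (le_trans (hM y)); exact: ltW.
Qed.

Lemma Rexpectation_cst (c : R) : (\int[P]_x c = c)%R.
Proof. by rewrite Rintegral_cst//= probability_setT mulr1. Qed.

Lemma Rexpectation_indic (A : set T) :
  measurable A -> (\int[P]_x (\1_A x) = fine (P A))%R.
Proof. by move=> mA; rewrite /Rintegral integral_indic//= setIT. Qed.

Lemma RexpectationD {f g} : bounded_mfun f -> bounded_mfun g ->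
  \int[P]_x (f x + g x) = \int[P]_x f x + \int[P]_x g x.
Proof. by move=> hf hg; rewrite RintegralD//; exact: bounded_mfun_integrable. Qed.

Lemma RexpectationB {f g} : bounded_mfun f -> bounded_mfun g ->
  \int[P]_x (f x - g x) = \int[P]_x f x - \int[P]_x g x.
Proof. by move=> hf hg; rewrite RintegralB//; exact: bounded_mfun_integrable. Qed.

Lemma RexpectationZ {f} (c : R) : bounded_mfun f ->
  \int[P]_x (c * f x) = c * \int[P]_x f x.
Proof. by move=> hf; rewrite RintegralZl//; exact: bounded_mfun_integrable. Qed.

Lemma ler_Rexpectation {f g} : bounded_mfun f -> bounded_mfun g ->
  (forall x, f x <= g x) -> \int[P]_x f x <= \int[P]_x g x.
Proof.
by move=> hf hg fg; apply: le_Rintegral => //; exact: bounded_mfun_integrable.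
Qed.

Lemma eq_Rexpectation {f} (g : T -> R) : f =1 g -> \int[P]_x f x = \int[P]_x g x.
Proof. by move=> fg; apply: eq_Rintegral => x _. Qed.

(** Dominated convergence with a constant as dominating function, integrable because [P] is
    finite. *)
Lemma bounded_convergence (F : nat -> T -> R) f (M : R) :
  (forall n, measurable_fun setT (F n)) -> (forall n x, `|F n x| <= M) ->
  (forall x, F n x @[n --> \oo] --> f x) ->
  bounded_mfun f /\ (\int[P]_x F n x)%R @[n --> \oo] --> (\int[P]_x f x)%R.
Proof.
move=> mF hM cF.
have mf : measurable_fun setT f.
  by apply: (measurable_fun_cvg mF) => x _; exact: cF.
have fM x : `|f x| <= M.
  have cn : `|F n x| @[n --> \oo] --> `|f x| by apply: cvg_norm; exact: cF.
  rewrite -(cvg_lim _ cn)//; apply: limr_le; last exact: nearW.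
  by apply/cvg_ex; exists `|f x|.
have bf : bounded_mfun f by split => //; exists M.
split => //.
have [| | | | |_ _] := @dominated_convergence _ _ _ P setT measurableT
  (fun n => EFin \o F n) (EFin \o f) (fun=> M%:E).
- by move=> n; exact/measurable_EFinP.
- exact/measurable_EFinP.
- by apply: aeW => x _ /=; apply: cvg_EFin; [exact: nearW|exact: cF].
- exact: (bounded_mfun_integrable (bounded_mfun_cst M)).
- by apply: aeW => x n _ /=; rewrite lee_fin.
move=> h; apply: fine_cvg; rewrite fineK//.
by apply: integrable_fin_num => //; exact: bounded_mfun_integrable.
Qed.
End bounded_measurable_functions.

Lemma bounded_mfun_comp {d d' : measure_display} {T : measurableType d}
    {T' : measurableType d'} {R : realType} {h : T' -> T} {f : T -> R} :
  measurable_fun setT h -> bounded_mfun f -> bounded_mfun (fun x => f (h x)).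
Proof.
move=> mh [mf [M hM]]; split; first exact: measurableT_comp.
by exists M.
Qed.

(* A function with values in [0, 1] is the uniform limit of its dyadic greedy
   expansions [G n], which satisfy [0 <= g - G n <= 2^-n]. *)
Lemma bounded_mfun_ind {d : measure_display} {T : measurableType d}
    {R : realType} (C : (T -> R) -> Prop) :
  (forall A, measurable A -> C \1_A) ->
  (forall f g, C f -> C g -> C (fun x => f x + g x)) ->
  (forall c f, C f -> C (fun x => c * f x)) ->
  (forall (F : nat -> T -> R) f M, (forall n, C (F n)) ->
     (forall n x, `|F n x| <= M) ->
     (forall x, F n x @[n --> \oo] --> f x) -> C f) ->
  forall f, bounded_mfun f -> C f.
Proof.
move=> C1 CD CZ Clim f [mf [M0 hM0]].
(* The extra 1 makes [M] positive, so that rescaling [f] to [g] with values in [0, 1] divides by a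
   nonzero number. *)
pose M := M0 + 1; have hM x : `|f x| <= M by rewrite (le_trans (hM0 x))// lerDl.
have M_gt0 : 0 < M by rewrite ltr_pwDr// (le_trans _ (hM0 point)).
pose g x := (f x + M) / (2 * M).
have g01 x : 0 <= g x <= 1.
  move: (hM x); rewrite ler_norml => /andP[h1 h2].
  by rewrite /g ler_pdivrMr ?divr_ge0 ?mulr_gt0//=; lra.
have mg : measurable_fun setT g.
  by apply: measurable_funM => //; exact: measurable_funD.
pose A (n : nat) (h : T -> R) := [set x | 2^-1 ^+ n.+1 <= g x - h x].
pose fix G (n : nat) : T -> R :=
  if n is m.+1 then fun x => G m x + 2^-1 ^+ m.+1 * \1_(A m (G m)) x
  else fun=> 0.
have mG n : measurable_fun setT (G n) /\ C (G n).
  elim: n => [|n [mGn CGn]].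
    split => //=; have := CZ 0 _ (C1 set0 measurable0).
    by congr C; apply/funext => x; rewrite mul0r.
  have mA : measurable (A n (G n)).
    rewrite /A -[X in measurable X]setTI.
    apply: measurable_fun_le => //; exact: measurable_funB.
  split => /=; last by apply: CD => //; apply: CZ; exact: C1.
  by apply: measurable_funD => //; apply: measurable_funM.
have G_approx n x : 0 <= G n x /\ 0 <= g x - G n x <= 2^-1 ^+ n.
  elim: n => [|n [IH0 /andP[IH1 IH2]]].
    by rewrite /= subr0 expr0; split.
  have -> : G n.+1 x = G n x + 2^-1 ^+ n.+1 * \1_(A n (G n)) x by [].
  have := exprS (2^-1 : R) n; move: IH0 IH1 IH2; rewrite indicE.
  have : 0 <= (2^-1 : R) ^+ n.+1 by rewrite exprn_ge0.
  have [|] := boolP (x \in A n (G n)); rewrite ?notin_setE ?inE /A/=;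
    move: (_ ^+ n.+1) (_ ^+ n) (G n x) (g x) => u v a b.
    move=> h1 h2 h3 h4 h5 h6.
    by rewrite mulr1; split; [lra|apply/andP; split; lra].
  move=> /negP; rewrite -ltNge => h1 h2 h3 h4 h5 h6.
  by rewrite mulr0 addr0; split => //; apply/andP; split; lra.
have Cg : C g.
  apply: (Clim G _ 1) => [n|n x|x]; first exact: (mG n).2.
    have [h0 /andP[h1 _]] := G_approx n x; have /andP[_ ?] := g01 x.
    by rewrite ger0_norm//; lra.
  apply/cvgrPdist_le => e e0.
  have : 2^-1 ^+ n @[n --> \oo] --> (0 : R).
    by apply: cvg_expr; rewrite ger0_norm ?invr_ge0// invf_lt1// ltr1n.
  move/cvgrPdist_le => /(_ e e0); apply: filterS => n.
  have [h0 /andP[h1 h2]] := G_approx n x.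
  by rewrite sub0r normrN ger0_norm ?exprn_ge0// => h; rewrite ger0_norm//; lra.
have := CD _ _ (CZ (2 * M) _ Cg) (CZ (- M) _ (C1 setT measurableT)).
congr C; apply/funext => x; rewrite indicT /g/=; field; lra.
Qed.

(** * Product rule for expectations *)

Section independent_factor.
Context {d : measure_display} {T : measurableType d} {R : realType}.
Context (P : probability T R) (X : {RV P >-> R}).

(** Both sides are linear in [f] and pass to bounded pointwise limits, so indicators suffice by
    [bounded_mfun_ind]. *)
Lemma Rexpectation_factor (Z : T -> R) : bounded_mfun Z ->
  (forall B : set R, measurable B ->
     \int[P]_w (\1_B (X w) * Z w) = fine (P (X @^-1` B)) * \int[P]_w Z w) ->
  forall f : R -> R, bounded_mfun f ->
    \int[P]_w (f (X w) * Z w) = (\int[P]_w f (X w)) * \int[P]_w Z w.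
Proof.
move=> bZ hZ f bf.
have mX : measurable_fun setT X by [].
pose C (f : R -> R) := bounded_mfun f /\
  \int[P]_w (f (X w) * Z w) = (\int[P]_w f (X w)) * \int[P]_w Z w.
suff [] : C f by [].
apply: bounded_mfun_ind => // {f bf}.
- move=> A mA; split; first exact: bounded_mfun_indic.
  rewrite hZ//; congr (_ * _); rewrite -Rexpectation_indic//.
  by rewrite -[_ @^-1` _]setTI; exact: mX.
- move=> f g [bf hf] [bg hg]; split; first exact: bounded_mfunD.
  have bfX := bounded_mfun_comp mX bf; have bgX := bounded_mfun_comp mX bg.
  rewrite (eq_Rexpectation _ (fun w => f (X w) * Z w + g (X w) * Z w)); last first.
    by move=> w; rewrite mulrDl.
  by rewrite !RexpectationD ?hf ?hg ?mulrDl//; exact: bounded_mfunM.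
- move=> c f [bf hf]; split; first exact: bounded_mfunZ.
  have bfX := bounded_mfun_comp mX bf.
  rewrite (eq_Rexpectation _ (fun w => c * (f (X w) * Z w))); last first.
    by move=> w; rewrite mulrA.
  by rewrite !RexpectationZ ?hf ?mulrA//; exact: bounded_mfunM.
- move=> F f M CF FM cF.
  have [mZ [N hN]] := bZ.
  have mF n : measurable_fun setT (F n) by have [[]] := CF n.
  have bf : bounded_mfun f.
    exact: (bounded_convergence (distribution P X) _ _ M _ _ _).1.
  split => //.
  have [_ h1] := bounded_convergence P (fun n w => F n (X w)) (f \o X) M
    (fun n => measurableT_comp (mF n) mX) (fun n x => FM n (X x))
    (fun x => cF (X x)).
  have [] := bounded_convergence P (fun n w => F n (X w) * Z w)
    (fun w => f (X w) * Z w) (M * N).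
  + by move=> n; apply: measurable_funM => //; exact: measurableT_comp.
  + by move=> n x; rewrite normrM ler_pM.
  + by move=> x; apply: cvgM; [exact: cF|exact: cvg_cst].
  move=> _ h2; apply: (cvg_unique _ h2) => //=.
  suff -> : (fun n => \int[P]_w (F n (X w) * Z w)) =
      (fun n => \int[P]_w F n (X w) * \int[P]_w Z w).
    by apply: cvgM; [exact: h1|exact: cvg_cst].
  by apply/funext => n; exact: (CF n).2.
Qed.

End independent_factor.

(** * Characteristic functions of independent sums *)

Local Open Scope complex_scope.

Lemma charfunE {d : measure_display} {T : measurableType d} {R : realType}
    (P : probability T R) (X : {RV P >-> R}) (u : R) :
  charfun X u = (\int[P]_w cos (u * X w)) +i* (\int[P]_w sin (u * X w)).
Proof. by rewrite /charfun unlock. Qed.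

Lemma bounded_mfun_cos {R : realType} (u v : R) :
  bounded_mfun (fun x : R => cos (u * x + v)).
Proof.
split.
  apply: measurableT_comp.
    by apply: continuous_measurable_fun; exact: continuous_cos.
  by apply: measurable_funD => //; exact: measurable_funM.
by exists 1 => x; rewrite ler_norml cos_geN1 cos_le1.
Qed.

Lemma bounded_mfun_sin {R : realType} (u : R) :
  bounded_mfun (fun x : R => sin (u * x)).
Proof.
split.
  apply: measurableT_comp.
    by apply: continuous_measurable_fun; exact: continuous_sin.
  exact: measurable_funM.
by exists 1 => x; rewrite ler_norml sin_geN1 sin_le1.
Qed.

Lemma bounded_mfun_cosl {R : realType} (u : R) :
  bounded_mfun (fun x : R => cos (u * x)).
Proof.
rewrite (_ : (fun x => _) = (fun x : R => cos (u * x + 0))).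
  exact: bounded_mfun_cos.
by apply/funext => x; rewrite addr0.
Qed.

Section independent_sum.
Context {d : measure_display} {T : measurableType d} {R : realType}.
Context (P : probability T R) (I : eqType) (X : I -> {RV P >-> R}).

Let mX i : measurable_fun setT (X i). Proof. by []. Qed.

Let event (s : seq I) (B : I -> set R) := \bigcap_(i in [set` s]) (X i @^-1` B i).

Let event_cons i s B : event (i :: s) B = X i @^-1` B i `&` event s B.
Proof.
apply/seteqP; split => w /=.
  move=> h; split; first by apply: h; rewrite /= mem_head.
  by move=> j js; apply: h; rewrite /= inE (_ : j \in s = true) ?orbT.
by move=> [h1 h2] j; rewrite /= inE => /predU1P[->//|]; exact: h2.
Qed.

Let measurable_event s B : (forall i, measurable (B i)) -> measurable (event s B).
Proof.
move=> mB; elim: s => [|i s IH].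
  by rewrite /event (_ : [set` [::]] = set0) ?bigcap_set0//; apply/seteqP; split.
rewrite event_cons; apply: measurableI => //.
by rewrite -[_ @^-1` _]setTI; exact: mX.
Qed.

Hypothesis indX : mutually_independent X.

(** Independence speaks of one family of sets, so [A] is put in place of [B i]; the event of [s] is
    unchanged because [i] is not in [s]. *)
Let event_indep i s B A : uniq (i :: s) -> (forall j, measurable (B j)) ->
  measurable A ->
  P (X i @^-1` A `&` event s B) = (P (X i @^-1` A) * P (event s B))%E.
Proof.
move=> /[dup] /= uis /andP[iNs us] mB mA.
pose B' j := if j == i then A else B j.
have mB' j : measurable (B' j) by rewrite /B'; case: ifP.
have eqB j : j \in s -> B' j = B j.
  by move=> js; rewrite /B' ifF//; apply: contraNF iNs => /eqP <-.
have -> : event s B = event s B'.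
  by apply: eq_bigcapr => j js; rewrite eqB.
have {1}-> : A = B' i by rewrite /B' eqxx.
rewrite -event_cons /event !indX// big_cons; congr (_ * _)%E.
by rewrite /B' eqxx.
Qed.

(* The indicator of an event about the remaining variables makes the induction
   on [s] go through: moving [i] from [s] to [s'] provides the product rule
   against [\1_A (X i)] that [Rexpectation_factor] needs. *)
Lemma charfun_indep_sum_event (c : I -> R) s s' B : uniq (s ++ s') ->
    (forall i, measurable (B i)) ->
  (\int[P]_w (cos (\sum_(i <- s) c i * X i w) * \1_(event s' B) w))
  +i* (\int[P]_w (sin (\sum_(i <- s) c i * X i w) * \1_(event s' B) w)) =
  (\prod_(i <- s) charfun (X i) (c i)) * (fine (P (event s' B)))%:C.
Proof.
elim: s s' B => [|i s IH] s' B.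
  move=> us' mB; rewrite big_nil mul1r.
  rewrite (eq_Rexpectation _ (\1_(event s' B))); last first.
    by move=> w; rewrite big_nil cos0 mul1r.
  rewrite [in X in _ +i* X](eq_Rexpectation _ (fun=> 0)); last first.
    by move=> w; rewrite big_nil sin0 mul0r.
  by rewrite Rexpectation_cst Rexpectation_indic//; exact: measurable_event.
move=> /= /andP[iNs us] mB.
have bS (f : R -> R) : bounded_mfun f ->
    bounded_mfun (fun w => f (\sum_(j <- s) c j * X j w) * \1_(event s' B) w).
  move=> bf; apply: bounded_mfunM; last first.
    by apply: bounded_mfun_indic; exact: measurable_event.
  apply: bounded_mfun_comp bf.
  apply: measurable_sum => j.
  exact: measurable_funM.
have bcos : bounded_mfun (cos : R -> R).
  by have := bounded_mfun_cosl (1 : R); congr bounded_mfun; apply/funext => x; rewrite mul1r.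
have bsin : bounded_mfun (sin : R -> R).
  by have := bounded_mfun_sin (1 : R); congr bounded_mfun; apply/funext => x; rewrite mul1r.
have uis' : uniq (i :: s').
  move: iNs us; rewrite /= mem_cat negb_or cat_uniq.
  by move=> /andP[_ ->] /and3P[_ _ ->].
(* The product rule on indicators that [Rexpectation_factor] asks for, with [Z] the cosine or sine
   of the remaining sum times the indicator of the event. *)
have IHA A : measurable A ->
  (\int[P]_w (\1_A (X i w) * (cos (\sum_(j <- s) c j * X j w) * \1_(event s' B) w)) =
    fine (P (X i @^-1` A)) * \int[P]_w (cos (\sum_(j <- s) c j * X j w) * \1_(event s' B) w)) /\
  (\int[P]_w (\1_A (X i w) * (sin (\sum_(j <- s) c j * X j w) * \1_(event s' B) w)) =
    fine (P (X i @^-1` A)) * \int[P]_w (sin (\sum_(j <- s) c j * X j w) * \1_(event s' B) w)).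
  move=> mA.
  pose B' j := if j == i then A else B j.
  have mB' j : measurable (B' j) by rewrite /B'; case: ifP.
  have eqB : event (i :: s') B' = X i @^-1` A `&` event s' B.
    rewrite event_cons {1}/B' eqxx; congr (_ `&` _).
    apply: eq_bigcapr => j js; rewrite /B' ifF//.
    by apply: contraTF uis' => /eqP <- /=; rewrite (_ : j \in s' = true).
  have := IH (i :: s') B'; rewrite eqB event_indep//.
  have ucat : uniq (s ++ i :: s').
    by rewrite uniq_catC /= mem_cat orbC -mem_cat iNs/= uniq_catC.
  move=> /(_ ucat mB').
  rewrite fineM ?fin_num_measure//; last 2 first.
    by rewrite -[_ @^-1` _]setTI; exact: mX.
    exact: measurable_event.
  rewrite rmorphM mulrCA -(IH s' B us mB).
  rewrite (eq_Rexpectation _ (fun w => \1_A (X i w) *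
    (cos (\sum_(j <- s) c j * X j w) * \1_(event s' B) w))); last first.
    by move=> w; rewrite indicI/= mulrCA.
  rewrite [in X in _ +i* X = _](eq_Rexpectation _ (fun w => \1_A (X i w) *
    (sin (\sum_(j <- s) c j * X j w) * \1_(event s' B) w))); last first.
    by move=> w; rewrite indicI/= mulrCA.
  by case; rewrite /= !mul0r subr0 addr0 => -> ->.
have Fcos := Rexpectation_factor _ (X i) _ (bS _ bcos) (fun A mA => (IHA A mA).1).
have Fsin := Rexpectation_factor _ (X i) _ (bS _ bsin) (fun A mA => (IHA A mA).2).
rewrite big_cons -mulrA -(IH s' B us mB) charfunE.
have bci := bounded_mfun_comp (mX i) (bounded_mfun_cosl (c i)).
have bsi := bounded_mfun_comp (mX i) (bounded_mfun_sin (c i)).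
(* The addition formulas split off the summand of [i]; after factoring, the two parts are those of a
   complex product. *)
rewrite (eq_Rexpectation _ (fun w =>
   cos (c i * X i w) * (cos (\sum_(j <- s) c j * X j w) * \1_(event s' B) w)
   - sin (c i * X i w) * (sin (\sum_(j <- s) c j * X j w) * \1_(event s' B) w))); last first.
  by move=> w; rewrite big_cons cosD; ring.
rewrite [in X in _ +i* X = _](eq_Rexpectation _ (fun w =>
   cos (c i * X i w) * (sin (\sum_(j <- s) c j * X j w) * \1_(event s' B) w)
   + sin (c i * X i w) * (cos (\sum_(j <- s) c j * X j w) * \1_(event s' B) w))); last first.
  by move=> w; rewrite big_cons sinD; ring.
rewrite RexpectationB ?RexpectationD; try (apply: bounded_mfunM => //; exact: bS).
rewrite (Fcos _ (bounded_mfun_cosl (c i))) (Fsin _ (bounded_mfun_cosl (c i))).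
by rewrite (Fcos _ (bounded_mfun_sin (c i))) (Fsin _ (bounded_mfun_sin (c i))).
Qed.

(** The case of no further indices, where the event is the whole space. *)
Lemma charfun_indep_sum (S : {RV P >-> R}) (c : I -> R) (s : seq I) : uniq s ->
    (forall w, S w = \sum_(i <- s) c i * X i w) ->
  forall u, charfun S u = \prod_(i <- s) charfun (X i) (c i * u).
Proof.
move=> us hS u.
have := charfun_indep_sum_event (fun i => c i * u) s [::] (fun=> setT).
rewrite cats0 /event => /(_ us (fun=> measurableT)).
rewrite (_ : [set` [::]] = set0); last by apply/seteqP; split.
rewrite bigcap_set0 probability_setT mulr1 => <-; rewrite charfunE.
have E w : \sum_(i <- s) c i * u * X i w = u * S w.
  by rewrite hS big_distrr/=; apply: eq_bigr => i _; rewrite mulrA (mulrC u).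
by congr (_ +i* _); apply: eq_Rexpectation => w; rewrite E indicT/= mulr1.
Qed.

End independent_sum.

(** * Uniqueness of characteristic functions *)

(** The phase [v] brings in sines and, with [u = 0], constants, so a single kind of generator is
    enough; [mul_coscos] gives closure under products. *)
Inductive trig_poly {R : realType} : (R -> R) -> Prop :=
| trig_poly_cos a u v : trig_poly (fun x => a * cos (u * x + v))
| trig_polyD f g : trig_poly f -> trig_poly g -> trig_poly (fun x => f x + g x).

Lemma mul_coscos {R : realType} (x y : R) :
  cos x * cos y = 2^-1 * cos (x + y) + 2^-1 * cos (x - y).
Proof. by rewrite cosD cosB; field. Qed.

Section trig_poly.
Context {R : realType}.
Implicit Types f g : R -> R.

Lemma trig_poly_cst (c : R) : trig_poly (fun=> c).
Proof.
have := trig_poly_cos c 0 0; congr trig_poly; apply/funext => x.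
by rewrite mul0r addr0 cos0 mulr1.
Qed.

Lemma trig_polyM f g :
  trig_poly f -> trig_poly g -> trig_poly (fun x => f x * g x).
Proof.
move=> hf hg; elim: hf => [a u v|f1 f2 _ IH1 _ IH2]; last first.
  have := trig_polyD _ _ IH1 IH2; congr trig_poly; apply/funext => x.
  by rewrite mulrDl.
elim: hg => [b u' v'|g1 g2 _ IH1 _ IH2]; last first.
  have := trig_polyD _ _ IH1 IH2; congr trig_poly; apply/funext => x.
  by rewrite mulrDr.
have := trig_polyD _ _ (trig_poly_cos (a * b / 2) (u + u') (v + v'))
  (trig_poly_cos (a * b / 2) (u - u') (v - v')).
congr trig_poly; apply/funext => x.
rewrite mulrACA mul_coscos (_ : u * x + v + _ = (u + u') * x + (v + v')); last by ring.
by rewrite (_ : u * x + v - _ = (u - u') * x + (v - v')); [field|ring].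
Qed.

Lemma bounded_mfun_trig_poly f : trig_poly f -> bounded_mfun f.
Proof.
elim=> [a u v|g h _ bg _ bh]; last exact: bounded_mfunD.
exact/bounded_mfunZ/bounded_mfun_cos.
Qed.

End trig_poly.

(* The cubic [y(3 - y^2)/2] moves every point of [-1, 1] towards its sign, so
   its iterates are polynomials converging boundedly to the sign function. *)
Definition sign_step {R : realType} (y : R) : R := y * (3 - y * y) / 2.

Section sign_step.
Context {R : realType}.
Implicit Types y : R.

Lemma iter_sign_stepN n y :
  iter n sign_step (- y) = - iter n sign_step y.
Proof.
by elim: n => //= n ->; rewrite /sign_step; field.
Qed.

(** For an iterate [z], [1 - sign_step z = (1 - z) (1 - (z + z^2) / 2)]. The iterates increase, so
    [z >= y], and the second factor is at most [1 - y / 2] because [z^2 >= 0]. *)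
Lemma iter_sign_step_pos n y : 0 <= y <= 1 ->
  y <= iter n sign_step y <= 1 /\ 1 - iter n sign_step y <= (1 - y / 2) ^+ n.
Proof.
move=> /andP[y0 y1]; elim: n => [|n [/andP[IH1 IH2] IH3]] /=.
  by rewrite lexx y1 expr0; split => //; lra.
set z := iter n _ y in IH1 IH2 IH3 *.
have z0 : 0 <= z by apply: le_trans IH1.
have E1 : sign_step z - z = z * (1 - z) * (1 + z) / 2 by rewrite /sign_step; field.
have h1 : 0 <= sign_step z - z by rewrite E1 divr_ge0 ?mulr_ge0//; lra.
have E2 : 1 - sign_step z = (1 - z) * (1 - (z + z * z) / 2) by rewrite /sign_step; field.
have zz : 0 <= z * z by rewrite mulr_ge0.
have zz1 : z * z <= 1 by rewrite mulr_ile1.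
have h2 : 0 <= 1 - sign_step z by rewrite E2; apply: mulr_ge0; lra.
split; first by apply/andP; split; lra.
rewrite E2 exprS mulrC; apply: ler_pM => //; lra.
Qed.

Lemma iter_sign_step_norm n y : `|y| <= 1 -> `|iter n sign_step y| <= 1.
Proof.
have pos (z : R) : 0 <= z -> `|z| <= 1 -> `|iter n sign_step z| <= 1.
  move=> z0; rewrite ger0_norm// => z1.
  have [|/andP[h1 h2] _] := iter_sign_step_pos n z; first by rewrite z0.
  by rewrite ger0_norm// (le_trans z0).
have [|/ltW] := leP 0 y; first exact: pos.
by move=> y0 hy; rewrite -(opprK y) iter_sign_stepN normrN pos ?normrN// oppr_ge0.
Qed.

Lemma iter_sign_step_cvg y : `|y| <= 1 ->
  iter n sign_step y @[n --> \oo] --> Num.sg y.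
Proof.
have pos (z : R) : 0 < z -> `|z| <= 1 -> iter n sign_step z @[n --> \oo] --> (1 : R).
  move=> z0; rewrite gtr0_norm// => z1.
  apply/cvgrPdist_le => e e0.
  have : (1 - z / 2) ^+ n @[n --> \oo] --> (0 : R).
    by apply: cvg_expr; rewrite ger0_norm; lra.
  move/cvgrPdist_le => /(_ e e0); apply: filterS => n.
  have [|/andP[h1 h2] h3] := iter_sign_step_pos n z; first by rewrite (ltW z0).
  rewrite sub0r normrN ger0_norm ?exprn_ge0//; last lra.
  by move=> h; rewrite ger0_norm ?subr_ge0// (le_trans h3).
have [y0|y0|<-] := ltgtP 0 y.
- by rewrite gtr0_sg//; exact: pos.
- move=> hy; rewrite ltr0_sg//.
  rewrite (_ : (fun n => _) = (fun n => - iter n sign_step (- y))).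
    by apply: cvgN; apply: pos; rewrite ?normrN// oppr_gt0.
  by apply/funext => n; rewrite iter_sign_stepN opprK.
- move=> _; rewrite sgr0; apply: cvg_near_cst; apply: nearW => n.
  by elim: n => //= n ->; rewrite /sign_step mul0r mul0r.
Qed.

Lemma trig_poly_iter_sign_step n (f : R -> R) :
  trig_poly f -> trig_poly (fun x => iter n sign_step (f x)).
Proof.
move=> hf; elim: n => //= n IH; rewrite /sign_step.
have := trig_polyM _ _ IH (trig_polyD _ _ (trig_poly_cst (3 / 2))
  (trig_polyM _ _ (trig_poly_cst (- 2^-1)) (trig_polyM _ _ IH IH))).
by congr trig_poly; apply/funext => x; field.
Qed.

End sign_step.

Section uniqueness.
Context {d d' : measure_display} {T : measurableType d} {T' : measurableType d'}.
Context {R : realType} {P : probability T R} {P' : probability T' R}.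
Context {X : {RV P >-> R}} {Y : {RV P' >-> R}}.

Let mX : measurable_fun setT X. Proof. by []. Qed.
Let mY : measurable_fun setT Y. Proof. by []. Qed.

Let same (f : R -> R) := bounded_mfun f /\
  \int[P]_w f (X w) = \int[P']_w f (Y w).

(** Bounded convergence holds under both laws, and limits are unique. *)
Let same_lim (F : nat -> R -> R) f M : (forall n, same (F n)) ->
  (forall n x, `|F n x| <= M) -> (forall x, F n x @[n --> \oo] --> f x) ->
  same f.
Proof.
move=> CF FM cF.
have mF n : measurable_fun setT (F n) by have [[]] := CF n.
have bf : bounded_mfun f.
  exact: (bounded_convergence (distribution P X) _ _ M _ _ _).1.
split => //.
have [_ h1] := bounded_convergence P (fun n w => F n (X w)) (f \o X) M
  (fun n => measurableT_comp (mF n) mX) (fun n x => FM n (X x))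
  (fun x => cF (X x)).
have [_ h2] := bounded_convergence P' (fun n w => F n (Y w)) (f \o Y) M
  (fun n => measurableT_comp (mF n) mY) (fun n x => FM n (Y x))
  (fun x => cF (Y x)).
apply: (cvg_unique _ h1) => //=.
suff -> : (fun n => \int[P]_w F n (X w)) = (fun n => \int[P']_w F n (Y w)).
  exact: h2.
by apply/funext => n; exact: (CF n).2.
Qed.

Hypothesis charXY : forall u, charfun X u = charfun Y u.

(** Expanding the phase leaves [cos (u * x)] and [sin (u * x)], whose means are the two parts of the
    characteristic function at [u]. *)
Let same_trig_poly f : trig_poly f -> same f.
Proof.
move=> tf; split; first exact: bounded_mfun_trig_poly.
elim: tf => [a u v|g h tg IHg th IHh]; last first.
  rewrite !RexpectationD ?IHg ?IHh//;
  by apply: bounded_mfun_comp => //; exact: bounded_mfun_trig_poly.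
have E (x : R) : a * cos (u * x + v) =
   a * cos v * cos (u * x) + - (a * sin v) * sin (u * x) by rewrite cosD; ring.
have bc := bounded_mfun_cosl u; have bs := bounded_mfun_sin u.
have bcX := bounded_mfun_comp mX bc; have bsX := bounded_mfun_comp mX bs.
have bcY := bounded_mfun_comp mY bc; have bsY := bounded_mfun_comp mY bs.
rewrite (eq_Rexpectation _ _ (fun w => E (X w))).
rewrite (eq_Rexpectation _ _ (fun w => E (Y w))).
rewrite !RexpectationD//; try exact: bounded_mfunZ.
rewrite !RexpectationZ//.
by have := charXY u; rewrite !charfunE => -[-> ->].
Qed.

(* [sgn(x - b)] is the limit of [sgn(sin((x - b) / n))] as n grows. *)
Let same_sg (b : R) : same (fun x => Num.sg (x - b)).
Proof.
apply: (same_lim (fun n x => Num.sg (sin ((x - b) / n.+1%:R))) _ 1).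
- move=> k; apply: (same_lim (fun n x => iter n sign_step (sin ((x - b) / k.+1%:R))) _ 1).
  + move=> n; apply: same_trig_poly; apply: trig_poly_iter_sign_step.
    (* The shift by [pi / 2] writes the sine as a cosine. *)
    have := trig_poly_cos 1 (k.+1%:R^-1) (- b / k.+1%:R - pi / 2).
    congr trig_poly; apply/funext => x.
    by rewrite mul1r addrA cosBpihalf mulrBl mulNr mulrC.
  + by move=> n x; apply: iter_sign_step_norm; rewrite ler_norml sin_geN1 sin_le1.
  + by move=> x; apply: iter_sign_step_cvg; rewrite ler_norml sin_geN1 sin_le1.
- by move=> n x; rewrite normr_sg lern1 leq_b1.
move=> x; apply: cvg_near_cst.
(* Once [n > y / pi], the argument lies strictly between 0 and [pi]. *)
have pos (y : R) : 0 < y -> \forall n \near \oo, Num.sg (sin (y / n.+1%:R)) = 1.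
  move=> y0; near=> n; rewrite gtr0_sg// sin_gt0_pi// divr_gt0//=.
  rewrite ltr_pdivrMr// mulrC -ltr_pdivrMr ?pi_gt0//.
  rewrite (@lt_le_trans _ _ n%:R) ?ler_nat//; near: n.
  exact: nbhs_infty_gtr.
have [h|h|h] := ltgtP 0 (x - b).
- by rewrite gtr0_sg//; exact: pos.
- rewrite ltr0_sg//; have := pos (b - x).
  rewrite -(opprB x b) oppr_gt0 => /(_ h); apply: filterS => n.
  by rewrite mulNr sinN sgrN => /eqP; rewrite eqr_oppLR => /eqP.
- by apply: nearW => n; rewrite -h mul0r sin0.
Unshelve. all: by end_near.
Qed.

Theorem charfun_inj x : cdf X x = cdf Y x.
Proof.
have [_] : same (fun y => 1 - 2 * \1_(`]-oo, x]) y).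
  (* Approaching [x] from the right gives the value -1 at [y = x] too, as the closed half-line
     requires. *)
  apply: (same_lim (fun n y => Num.sg (y - (x + n.+1%:R^-1))) _ 1).
  - by move=> n; exact: same_sg.
  - by move=> n y; rewrite normr_sg lern1 leq_b1.
  - move=> y; apply: cvg_near_cst; rewrite indicE.
    have [yx|xy] := leP y x.
      apply: nearW => n; rewrite mem_set/= ?in_itv//= mulr1 ltr0_sg; first by ring.
      by rewrite subr_lt0 (le_lt_trans yx)// ltrDl invr_gt0.
    near=> n; rewrite memNset/=; last by rewrite in_itv/= leNgt xy.
    rewrite mulr0 subr0 gtr0_sg// subr_gt0 -ltrBrDl.
    rewrite invf_plt ?posrE ?subr_gt0//.
    rewrite (@lt_le_trans _ _ n%:R) ?ler_nat//; near: n.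
    exact: nbhs_infty_gtr.
have mI : measurable (`]-oo, x]%classic : set R) by [].
have bI : bounded_mfun (\1_(`]-oo, x]) : R -> R) := bounded_mfun_indic mI.
have bIX := bounded_mfun_comp mX bI; have bIY := bounded_mfun_comp mY bI.
rewrite !RexpectationB ?RexpectationZ//; try exact: bounded_mfunZ; try exact: bounded_mfun_cst.
rewrite !Rexpectation_cst => /addrI/oppr_inj/(mulfI _) h.
have mXI : measurable (X @^-1` `]-oo, x]) by rewrite -[_ @^-1` _]setTI; exact: mX.
have mYI : measurable (Y @^-1` `]-oo, x]) by rewrite -[_ @^-1` _]setTI; exact: mY.
have {}h := h (lt0r_neq0 (ltr0Sn _ 1)).
have EX := Rexpectation_indic P _ mXI; have EY := Rexpectation_indic P' _ mYI.
rewrite /cdf /distribution/= /pushforward -[LHS]fineK ?fin_num_measure//.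
by rewrite -[RHS]fineK ?fin_num_measure// -EX -EY; congr (_%:E).
Unshelve. all: by end_near.
Qed.

End uniqueness.

(** * Quantiles *)

Section quantile.
Context {d : measure_display} {T : measurableType d} {R : realType}.
Context {P : probability T R}.
Implicit Types X Y : {RV P >-> R}.

Let level_set X p := [set x : R | (p%:E <= cdf X x)%E].

(** The cdf tends to 1 at plus infinity. With the lower bound below, this makes [quantile] a genuine
    infimum rather than a default value. *)
Lemma level_set_nonempty X p : p < 1 -> level_set X p !=set0.
Proof.
move=> p1.
have h : nbhs (+oo%R : set_system R) (fun x => (p%:E < cdf X x)%E) :=
  cvg_cdfy1 (P := P) X (@nbhs_open_ereal_gt R 1 (fun=> p) p1).
by have /filter_ex[x /ltW hx] := h; exists x.
Qed.

Lemma level_set_lbound X p : 0 < p -> has_lbound (level_set X p).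
Proof.
move=> p0; have h : nbhs (-oo%R : set_system R) (fun x => (cdf X x < p%:E)%E) :=
  cvg_cdfNy0 (P := P) X (@nbhs_open_ereal_lt R 0 (fun=> p) p0).
have /filter_ex[x hx] := h; exists x => y hy; rewrite leNgt; apply/negP => yx.
have := le_lt_trans (cdf_nondecreasing X (ltW yx)) hx.
by rewrite ltNge hy.
Qed.

Lemma le_quantile X p x : 0 < p -> (p%:E <= cdf X x)%E -> quantile X p <= x.
Proof. by move=> p0 h; apply: ge_inf => //; exact: level_set_lbound. Qed.

(** With a strict inequality, monotonicity of the cdf suffices; right-continuity does not enter. *)
Lemma cdf_ge_quantile X p x : p < 1 -> quantile X p < x -> (p%:E <= cdf X x)%E.
Proof.
move=> p1 h; rewrite leNgt; apply/negP => hx; move: h; apply/negP; rewrite -leNgt.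
apply: lb_le_inf; first exact: level_set_nonempty.
move=> y hy; rewrite leNgt; apply/negP => yx.
have := le_lt_trans (cdf_nondecreasing X (ltW yx)) hx.
by rewrite ltNge hy.
Qed.

(** The increasing map [y |-> c * y + m] carries one level set onto the other, hence also the
    infima. *)
Lemma quantile_affine X Y c m p : 0 < c -> 0 < p -> p < 1 ->
    (forall x, cdf X x = cdf Y ((x - m) / c)) ->
  quantile X p = c * quantile Y p + m.
Proof.
move=> c0 p0 p1 XY; apply/eqP; rewrite eq_le; apply/andP; split.
  rewrite -lerBlDr mulrC -ler_pdivrMr//.
  apply: lb_le_inf; first exact: level_set_nonempty.
  move=> y hy; rewrite ler_pdivrMr// lerBlDr mulrC.
  apply: le_quantile => //; rewrite XY (_ : _ / c = y)//.
  by field; rewrite gt_eqF.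
apply: lb_le_inf; first exact: level_set_nonempty.
move=> y; rewrite /= XY => hy.
by rewrite -lerBrDr mulrC -ler_pdivlMr//; exact: le_quantile.
Qed.

(** Otherwise every interval [G n] around [a = quantile X p1] has mass at least [p2 - p1]. These
    intervals shrink to the point [a], which would then be an atom. *)
Lemma quantile_lt X p1 p2 : (forall a, P (X @^-1` [set a]) = 0%E) ->
  0 < p1 -> p1 < p2 -> p2 < 1 -> quantile X p1 < quantile X p2.
Proof.
move=> noatom p10 p12 p21; rewrite ltNge; apply/negP.
set a := quantile X p1 => le21.
have mX : measurable_fun setT X by [].
have mXA (A : set R) : measurable A -> measurable (X @^-1` A).
  by move=> mA; rewrite -[_ @^-1` _]setTI; exact: mX.
pose G n : set R := `]a - n.+1%:R^-1, a + n.+1%:R^-1]%classic.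
have mG n : measurable (G n) by exact: measurable_itv.
have inv_gt0 n : 0 < n.+1%:R^-1 :> R by rewrite invr_gt0.
have PG n : p2 - p1 <= \int[P]_w \1_(G n) (X w).
  have -> : \int[P]_w \1_(G n) (X w) = fine (P (X @^-1` G n)).
    by rewrite -Rexpectation_indic//; exact: mXA.
  have h1 : (cdf X (a - n.+1%:R^-1) < p1%:E)%E.
    rewrite ltNge; apply/negP => /(le_quantile _ _ _ p10).
    by rewrite -/a leNgt ltrBlDr ltrDl inv_gt0.
  have h2 : (p2%:E <= cdf X (a + n.+1%:R^-1))%E.
    by apply: cdf_ge_quantile => //; rewrite (le_lt_trans le21)// ltrDl.
  have : cdf X (a + n.+1%:R^-1) = (cdf X (a - n.+1%:R^-1) + P (X @^-1` G n))%E.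
    rewrite /cdf /distribution /pushforward/= -measureU//; last 3 first.
    - exact: mXA.
    - exact: mXA.
    - rewrite -preimage_setI (_ : _ `&` _ = set0) ?preimage_set0//.
      apply/seteqP; split => // x []; rewrite /G/= !in_itv/= => h3 /andP[h4 _].
      by move: h4; rewrite ltNge h3.
    rewrite -preimage_setU; congr (P (X @^-1` _)).
    apply/seteqP; split => x; rewrite /G/= !in_itv/= => h3.
      by have [|] := leP x (a - n.+1%:R^-1); [left|right; rewrite h3].
    case: h3 => [h3|/andP[]//]; rewrite (le_trans h3)// lerD2l.
    by rewrite (@le_trans _ _ 0)// ?oppr_le0 ltW.
  move: h1 h2; rewrite /cdf /distribution /pushforward.
  rewrite -[X in (X < _)%E]fineK ?fin_num_measure//; last exact: mXA.
  rewrite -[X in (_ <= X)%E -> _]fineK ?fin_num_measure//; last exact: mXA.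
  rewrite lte_fin lee_fin => h1 h2 h3.
  move: (h3); rewrite -[X in (X + _)%E]fineK ?fin_num_measure//; last exact: mXA.
  rewrite -[X in (_ + X)%E]fineK ?fin_num_measure//; last exact: mXA.
  move=> /(congr1 fine) /=; lra.
have [] := bounded_convergence P (fun n w => \1_(G n) (X w) : R)
  (fun w => \1_[set a] (X w)) 1.
- move=> n; exact: (bounded_mfun_comp mX (bounded_mfun_indic (mG n))).1.
- by move=> n x; rewrite indicE normr_nat lern1 leq_b1.
- move=> w; apply: cvg_near_cst; rewrite indicE.
  have [/eqP Xa|Xa] := boolP (X w == a).
    apply: nearW => n; rewrite indicE !mem_set//= /G/= in_itv/= Xa.
    by rewrite ltrBlDr ltrDl lerDl inv_gt0 (ltW (inv_gt0 n)).
  near=> n; rewrite indicE [in RHS]memNset/=; last exact/eqP.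
  rewrite memNset// /G/= in_itv/= => /andP[h1 h2].
  have : `|X w - a| <= n.+1%:R^-1 by rewrite ler_distl h2 ltW.
  rewrite leNgt => /negP; apply.
  rewrite invf_plt ?posrE ?normr_gt0 ?subr_eq0//.
  rewrite (@lt_le_trans _ _ n%:R) ?ler_nat//; near: n.
  exact: nbhs_infty_gtr.
move=> _ cG.
have : p2 - p1 <= \int[P]_w \1_[set a] (X w).
  rewrite -(cvg_lim _ cG)//; apply: limr_ge; last exact: nearW.
  by apply/cvg_ex; eexists; exact: cG.
have -> : \int[P]_w \1_[set a] (X w) = fine (P (X @^-1` [set a])).
  by rewrite -Rexpectation_indic//; exact: mXA.
rewrite noatom/=; lra.
Unshelve. all: by end_near.
Qed.

End quantile.

(** * Absence of atoms *)

Section no_atoms.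
Context {d : measure_display} {T : measurableType d} {R : realType}.
Context {P : probability T R} {X : {RV P >-> R}}.

Let mX : measurable_fun setT X. Proof. by []. Qed.

Hypothesis charfun_cvg0 : forall eps : R, 0 < eps -> exists U, forall u, U <= u ->
  `|complex.Re (charfun X u)| <= eps /\ `|complex.Im (charfun X u)| <= eps.

(** Multiplying a cosine of frequency [u0] by one of frequency [u] gives the frequencies [u + u0]
    and [u - u0], which both grow with [u]. The bound is uniform in the phase [v]. *)
Let trig_poly_decay f : trig_poly f -> forall eps : R, 0 < eps ->
  exists U, forall u v, U <= u ->
    `|\int[P]_w (f (X w) * cos (u * X w + v))| <= eps.
Proof.
have bcos u v := bounded_mfun_comp mX (bounded_mfun_cos u v).
have cos_decay (eps : R) : 0 < eps -> exists U, forall u v, U <= u ->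
    `|\int[P]_w (cos (u * X w + v))| <= eps.
  move=> eps0; have [U hU] := charfun_cvg0 _ (divr_gt0 eps0 (ltr0Sn R 1)).
  exists U => u v /hU; rewrite charfunE/= => -[h1 h2].
  rewrite (eq_Rexpectation _ (fun w => cos v * cos (u * X w) - sin v * sin (u * X w))).
    have bc := bounded_mfun_comp mX (bounded_mfun_cosl u).
    have bs := bounded_mfun_comp mX (bounded_mfun_sin u).
    rewrite RexpectationB ?RexpectationZ//; try exact: bounded_mfunZ.
    rewrite (le_trans (ler_normB _ _))// [leRHS](splitr eps) !normrM.
    by apply: lerD; rewrite -[leRHS]mul1r; apply: ler_pM => //;
      rewrite ler_norml ?cos_geN1 ?cos_le1 ?sin_geN1 ?sin_le1.
  by move=> w; rewrite cosD; ring.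
elim=> [a u0 v0|g h tg IHg th IHh] eps eps0; last first.
  have [U1 h1] := IHg _ (divr_gt0 eps0 (ltr0Sn R 1)).
  have [U2 h2] := IHh _ (divr_gt0 eps0 (ltr0Sn R 1)).
  exists (Num.max U1 U2) => u v; rewrite ge_max => /andP[/h1 {}h1 /h2 {}h2].
  rewrite (eq_Rexpectation _ (fun w => g (X w) * cos (u * X w + v) +
    h (X w) * cos (u * X w + v))); last by move=> w; rewrite mulrDl.
  have bg := bounded_mfun_comp mX (bounded_mfun_trig_poly _ tg).
  have bh := bounded_mfun_comp mX (bounded_mfun_trig_poly _ th).
  rewrite RexpectationD; try exact: bounded_mfunM.
  by rewrite (le_trans (ler_normD _ _))// [leRHS](splitr eps) lerD.
(* The summand 1 covers [a = 0]. *)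
have e1 : 0 < eps / (`|a| + 1) by rewrite divr_gt0// ltr_wpDl.
have [U hU] := cos_decay _ e1.
(* Beyond this threshold both [u + u0] and [u - u0] are at least [U]. *)
exists (U + `|u0|) => u v hu.
rewrite (eq_Rexpectation _ (fun w =>
    a / 2 * cos ((u + u0) * X w + (v + v0)) + a / 2 * cos ((u - u0) * X w + (v - v0)))).
  rewrite RexpectationD ?RexpectationZ//; try exact: bounded_mfunZ.
  have /hU h1 : U <= u + u0 by have := ler_norm (- u0); rewrite normrN; lra.
  have /hU h2 : U <= u - u0 by have := ler_norm u0; lra.
  rewrite -mulrDr normrM.
  have h3 := lerD (h1 (v + v0)) (h2 (v - v0)).
  have h4 := le_trans (ler_normD _ _) h3.
  apply: (le_trans (ler_wpM2l (normr_ge0 _) h4)).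
  rewrite normrM normfV (ger0_norm (ler0n R 2)).
  rewrite [leLHS](_ : _ = eps * (`|a| / (`|a| + 1))); last first.
    by field; rewrite gt_eqF// ltr_wpDl.
  by rewrite ler_piMr ?(ltW eps0)// ler_pdivrMr ?mul1r ?lerDl// ltr_wpDl.
move=> w; rewrite -mulrA (mulrC (cos _)) mul_coscos.
rewrite (_ : u * X w + v + _ = (u + u0) * X w + (v + v0)); last by ring.
by rewrite (_ : u * X w + v - _ = (u - u0) * X w + (v - v0)); [field|ring].
Qed.

(* Multiplying a nonnegative trigonometric polynomial that is 1 at [a] by
   [(1 + cos (u (x - a))) / 2] asymptotically halves its mean as u grows. *)
Lemma charfun_cvg0_no_atom a : P (X @^-1` [set a]) = 0%E.
Proof.
have approx n : exists f : R -> R, [/\ trig_poly f, forall x, 0 <= f x, f a = 1 &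
    \int[P]_w f (X w) <= (3 / 4) ^+ n].
  elim: n => [|n [f [tf f0 fa hf]]].
    exists (fun=> 1); split => //; first exact: trig_poly_cst.
    by rewrite Rexpectation_cst expr0.
  (* With this error the new mean is at most [(1/2 + 1/4) (3/4)^n], that is [(3/4)^(n+1)]. *)
  have e0 : 0 < (3 / 4 : R) ^+ n / 2 by rewrite divr_gt0// exprn_gt0.
  have [U hU] := trig_poly_decay _ tf _ e0.
  pose h x := f x * (1 / 2 + 1 / 2 * cos (U * x + - (U * a))).
  exists h; split.
  - apply: trig_polyM => //; apply: trig_polyD; [exact: trig_poly_cst|exact: trig_poly_cos].
  - by move=> x; apply: mulr_ge0 => //; have := cos_geN1 (U * x + - (U * a)); lra.
  - by rewrite /h subrr cos0 fa; lra.
  have bf := bounded_mfun_comp mX (bounded_mfun_trig_poly _ tf).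
  have bc := bounded_mfun_comp mX (bounded_mfun_cos U (- (U * a))).
  rewrite (eq_Rexpectation _ (fun w => 1 / 2 * f (X w) +
      1 / 2 * (f (X w) * cos (U * X w + - (U * a))))); last by move=> w; rewrite /h; ring.
  rewrite RexpectationD ?RexpectationZ//;
    try (do ?apply: bounded_mfunZ; first [exact: bf|exact: bounded_mfunM]).
  have := le_trans (ler_norm _) (hU U (- (U * a)) (lexx U)).
  rewrite exprS; move: hf; lra.
have mA : measurable (X @^-1` [set a]) by rewrite -[_ @^-1` _]setTI; exact: mX.
rewrite -[LHS]fineK ?fin_num_measure//; congr (_%:E).
apply/eqP; rewrite eq_le fine_ge0// andbT.
(* Being nonnegative and 1 at [a], [f] dominates the indicator of the point. *)
have le_geo n : fine (P (X @^-1` [set a])) <= (3 / 4) ^+ n.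
  have [f [tf f0 fa hf]] := approx n; apply: le_trans hf.
  rewrite -Rexpectation_indic//; apply: ler_Rexpectation.
  - exact: bounded_mfun_indic.
  - exact: bounded_mfun_comp mX (bounded_mfun_trig_poly _ tf).
  - move=> w; rewrite indicE; have [|_] := boolP (w \in _) => //.
    by rewrite inE/= => ->; rewrite fa.
have geo0 : (3 / 4) ^+ n @[n --> \oo] --> (0 : R).
  by apply: cvg_expr; rewrite ger0_norm; lra.
rewrite -(cvg_lim _ geo0)//; apply: limr_ge; last exact: nearW.
by apply/cvg_ex; exists 0.
Qed.

End no_atoms.

(** * The complex exponential and affine images of random variables *)

Section cexp.
Context {R : realType}.

Lemma cexp0 : cexp (0 : R[i]) = 1.
Proof. by rewrite /cexp /= expR0 cos0 sin0 mul1r. Qed.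

Lemma cexpD (z1 z2 : R[i]) : cexp (z1 + z2) = cexp z1 * cexp z2.
Proof.
case: z1 z2 => [a b] [c e]; rewrite /cexp /= expRD cosD sinD.
by apply/eqP; rewrite eq_complex /=; apply/andP; split; apply/eqP; ring.
Qed.

Lemma cexp_sum (I : Type) (s : seq I) (z : I -> R[i]) :
  \prod_(i <- s) cexp (z i) = cexp (\sum_(i <- s) z i).
Proof. by elim/big_rec2: _ => [|i x y _ ->]; rewrite ?cexp0 ?cexpD. Qed.

Lemma norm_cexp_le (z : R[i]) : `|complex.Re (cexp z)| <= expR (complex.Re z) /\
  `|complex.Im (cexp z)| <= expR (complex.Re z).
Proof.
rewrite /cexp /= !mul0r subr0 addr0; split;
  rewrite normrM ger0_norm ?expR_ge0// -[leRHS]mulr1 ler_wpM2l ?expR_ge0//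
    ler_norml ?cos_geN1 ?cos_le1 ?sin_geN1 ?sin_le1//.
Qed.

Lemma Re_sum (I : Type) (s : seq I) (z : I -> R[i]) :
  complex.Re (\sum_(i <- s) z i) = \sum_(i <- s) complex.Re (z i).
Proof. by elim/big_rec2: _ => // i x y _ <-; case: (z i) => a b; case: y. Qed.

Lemma Im_sum (I : Type) (s : seq I) (z : I -> R[i]) :
  complex.Im (\sum_(i <- s) z i) = \sum_(i <- s) complex.Im (z i).
Proof. by elim/big_rec2: _ => // i x y _ <-; case: (z i) => a b; case: y. Qed.

End cexp.

Section affine.
Context {d : measure_display} {T : measurableType d} {R : realType}.
Context {P : probability T R} {X Y : {RV P >-> R}}.

Lemma charfun_affine (c m : R) : (forall w, Y w = c * X w + m) ->
  forall u, charfun Y u = charfun X (c * u) * cexp (0 +i* (m * u)).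
Proof.
move=> hY u; rewrite !charfunE /cexp /= expR0.
have mX : measurable_fun setT X by [].
have bc := bounded_mfun_comp mX (bounded_mfun_cosl (c * u)).
have bs := bounded_mfun_comp mX (bounded_mfun_sin (c * u)).
have E w : u * Y w = c * u * X w + m * u by rewrite hY; ring.
rewrite (eq_Rexpectation _ (fun w => cos (m * u) * cos (c * u * X w) -
  sin (m * u) * sin (c * u * X w))); last by move=> w; rewrite E cosD; ring.
rewrite [in X in _ +i* X](eq_Rexpectation _ (fun w => sin (m * u) * cos (c * u * X w) +
  cos (m * u) * sin (c * u * X w))); last by move=> w; rewrite E sinD; ring.
rewrite RexpectationB ?RexpectationD; try exact: bounded_mfunZ.
rewrite !RexpectationZ//.
by apply/eqP; rewrite eq_complex /=; apply/andP; split; apply/eqP; ring.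
Qed.

Lemma cdf_affine (c m : R) : 0 < c -> (forall w, Y w = c * X w + m) ->
  forall x, cdf Y x = cdf X ((x - m) / c).
Proof.
move=> c0 hY x; rewrite /cdf /distribution /pushforward; congr (P _).
apply/seteqP; split => w /=; rewrite !in_itv/= hY;
  by rewrite ler_pdivlMr// lerBrDr mulrC.
Qed.

End affine.

(** * Stable laws *)

Section stable_law.
Context {R : realType}.
Implicit Types alpha beta gamma delta u c : R.

(** The imaginary part of the exponent. Since [Num.sg 0 = 0], it vanishes at [u = 0], so that point
    needs no case of its own. *)
Definition stable0_phase alpha beta gamma delta u : R :=
  - (gamma `^ alpha * `|u| `^ alpha * (beta * Num.sg u *
     (if alpha == 1 then 2 / pi * ln (gamma * `|u|)
      else tan (pi * alpha / 2) * ((gamma * `|u|) `^ (1 - alpha) - 1))))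
  + delta * u.

Lemma stable0_charfunE alpha beta gamma delta u : 0 < alpha -> 0 < gamma ->
  stable0_charfun alpha beta gamma delta u =
  cexp (- (gamma `^ alpha * `|u| `^ alpha) +i*
        stable0_phase alpha beta gamma delta u).
Proof.
move=> alpha0 gamma0; rewrite /stable0_charfun /stable0_phase.
have [->|u0] := eqVneq u 0.
  rewrite normr0 powR0; last by rewrite gt_eqF.
  by rewrite sgr0 !(mulr0, mul0r) oppr0 addr0 cexp0.
have [->|alpha1] := eqVneq alpha 1; congr cexp;
  apply/eqP; rewrite eq_complex /=; apply/andP; split; apply/eqP.
- by rewrite !powRr1 ?(ltW gamma0)//; ring.
- by rewrite !powRr1 ?(ltW gamma0)//; ring.
- by ring.
- by ring.
Qed.

Lemma stable0_phase0 alpha beta gamma delta :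
  stable0_phase alpha beta gamma delta 0 = 0.
Proof. by rewrite /stable0_phase sgr0 !(mulr0, mul0r) oppr0 addr0. Qed.

Lemma stable0_phase_sym alpha gamma delta u :
  stable0_phase alpha 0 gamma delta u = delta * u.
Proof. by rewrite /stable0_phase !mul0r mulr0 oppr0 add0r. Qed.

(* In the S^0 parameterisation a change of scale preserves the skewness and
   only shifts the location: the phase is homogeneous up to a linear term. *)
Lemma stable0_phase_scale alpha beta gamma delta c :
    0 < alpha -> 0 < gamma -> 0 <= c ->
  exists l, forall u, stable0_phase alpha beta gamma delta (c * u) =
    c `^ alpha * stable0_phase alpha beta gamma delta u + l * u.
Proof.
(* The case [c = 0] is kept apart because [ln c] and the powers of [c] obey their laws only for
   [c > 0]; vanishing weights do occur. *)
move=> alpha0 gamma0; rewrite le_eqVlt => /predU1P[<-|c0].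
  exists 0 => u; rewrite !mul0r stable0_phase0 powR0 ?mul0r ?addr0//.
  by rewrite gt_eqF.
(* For [alpha = 1] the term comes from [ln (c * x) = ln c + ln x]. Otherwise the exponent is a part
   homogeneous of degree [alpha] plus a linear part, and the linear part scales by [c] instead of
   the power [alpha] of [c]. *)
pose l := if alpha == 1 then - (gamma * beta * (2 / pi) * c * ln c)
  else (delta - beta * tan (pi * alpha / 2) * gamma) * (c - c `^ alpha).
exists l => u; have [->|u0] := eqVneq u 0.
  by rewrite !mulr0 stable0_phase0 mulr0 addr0.
have a0 : 0 < `|u| by rewrite normr_gt0.
rewrite /stable0_phase sgrM (gtr0_sg c0) mul1r normrM (gtr0_norm c0).
rewrite /l; move: (numEsg u); move: (Num.sg u) `|u| a0 => s a a0 ->.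
have [->|alpha1] := eqVneq alpha 1.
  rewrite !powRr1 ?mulr_ge0 ?(ltW a0) ?(ltW c0) ?(ltW gamma0)//.
  rewrite !lnM ?posrE ?mulr_gt0//.
  by ring.
(* After [H1] and [H2] all powers can be generalized, and a polynomial identity remains. *)
have H1 : c `^ alpha * c `^ (1 - alpha) = c.
  rewrite -powRD; last by rewrite (gt_eqF c0) implybT.
  by rewrite subrKC powRr1// ltW.
have H2 : gamma `^ alpha * a `^ alpha * (gamma * a) `^ (1 - alpha) =
    gamma * a.
  rewrite -powRM ?(ltW gamma0) ?(ltW a0)// -powRD; last first.
    by rewrite (gt_eqF (mulr_gt0 gamma0 a0)) implybT.
  by rewrite subrKC powRr1// mulr_ge0// ltW.
rewrite (mulrCA gamma c a) !(powRM _ (ltW c0)) ?mulr_ge0 ?(ltW a0) ?(ltW gamma0)//.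
move: H1 H2.
move: (c `^ _) (c `^ _) (gamma `^ _) (a `^ _) ((gamma * _) `^ _) => A B G D W.
move=> H1 H2; ring: H1 H2.
Qed.

Lemma powR_ge_eventually alpha (M : R) : 0 < alpha ->
  exists U, forall u, U <= u -> M <= u `^ alpha.
Proof.
move=> alpha0; exists (Num.max 0 M `^ alpha^-1) => u hu.
have M0 : 0 <= Num.max 0 M by rewrite le_max lexx.
rewrite (@le_trans _ _ (Num.max 0 M))// ?le_max ?lexx ?orbT//.
rewrite -[leLHS](powRr1 M0) -(mulVf (lt0r_neq0 alpha0)) powRrM.
by rewrite ge0_ler_powR// ?nnegrE ?powR_ge0 ?(ltW alpha0)// (le_trans _ hu) ?powR_ge0.
Qed.

Lemma stable0_charfun_cvg0 alpha beta gamma delta : 0 < alpha -> 0 < gamma ->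
  forall eps, 0 < eps -> exists U, forall u, U <= u ->
    `|complex.Re (stable0_charfun alpha beta gamma delta u)| <= eps /\
    `|complex.Im (stable0_charfun alpha beta gamma delta u)| <= eps.
Proof.
move=> alpha0 gamma0 eps eps0.
(* The modulus is the exponential of [- (gamma |u|)^alpha]; the threshold brings it down to
   [eps]. *)
have [U hU] := powR_ge_eventually alpha (- ln eps / gamma `^ alpha) alpha0.
exists (Num.max U 0) => u; rewrite ge_max => /andP[/hU {}hU u0].
rewrite stable0_charfunE//.
set z := (_ +i* _); have [h1 h2] := norm_cexp_le z.
have h3 : expR (complex.Re z) <= eps.
  rewrite -[leRHS]lnK ?posrE// ler_expR /z /= lerNl (ger0_norm u0).
  by rewrite mulrC -ler_pdivrMr ?powR_gt0.
by split; [apply: le_trans h1 _|apply: le_trans h2 _].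
Qed.

End stable_law.

(** * Weighted sums of independent stable variables *)

Section stable_sum.
Context {d : measure_display} {T : measurableType d} {R : realType}.
Context {P : probability T R} {I : eqType} {X : I -> {RV P >-> R}}.
Context {alpha beta gamma delta : R}.
Hypotheses (alpha_gt0 : 0 < alpha) (gamma_gt0 : 0 < gamma).
Hypothesis indX : mutually_independent X.
Hypothesis stableX : forall i, has_stable0_law (X i) alpha beta gamma delta.

Lemma log_quantile_diff_stable_sum (S : {RV P >-> R}) (s : seq I) (c : I -> R)
    (p1 p2 : R) (i0 : I) :
    uniq s -> (forall w, S w = \sum_(i <- s) c i * X i w) ->
    0 < \sum_(i <- s) `|c i| `^ alpha ->
    beta = 0 \/ (forall i, i \in s -> 0 <= c i) ->
    0 < p1 -> p1 < p2 -> p2 < 1 ->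
  log_quantile_diff S p1 p2 =
  alpha^-1 * ln (\sum_(i <- s) `|c i| `^ alpha) + log_quantile_diff (X i0) p1 p2.
Proof.
move=> us hS; set C := \sum_(i <- s) _ => C0 hc p10 p12 p21.
(* The scale for which [S] and [k * X i0] have characteristic functions of equal modulus; only the
   phases remain to be compared, up to a linear term. *)
pose k := C `^ alpha^-1; have k0 : 0 < k by exact: powR_gt0.
have kC : k `^ alpha = C.
  by rewrite -powRrM mulVf ?gt_eqF// powRr1// ltW.
pose phase := stable0_phase alpha beta gamma delta.
have [m hm] : exists m, forall u,
    \sum_(i <- s) phase (c i * u) = phase (k * u) + m * u.
  case: hc => [b0|c_ge0].
    exists (delta * (\sum_(i <- s) c i - k)) => u.
    rewrite /phase b0 stable0_phase_sym mulrBr mulrBl mulrA subrKC.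
    rewrite -mulrA mulr_suml mulr_sumr.
    by apply: eq_bigr => i _; rewrite stable0_phase_sym.
  have [l hl] := stable0_phase_scale alpha beta gamma delta k alpha_gt0 gamma_gt0 (ltW k0).
  rewrite -/phase in hl.
  (* The scaling lemma is summed over [s], the linear terms adding up. Applied once more at [k], it
     replaces [C * phase u] by [phase (k * u)] up to a linear term. *)
  have [m hm] : exists m, forall u, \sum_(i <- s) phase (c i * u) =
      C * phase u + m * u.
    rewrite /C; elim: (s) c_ge0 => [|i s' IH] c_ge0.
      by exists 0 => u; rewrite !big_nil !mul0r addr0.
    have [|m' hm'] := IH; first by move=> j js; rewrite c_ge0// inE js orbT.
    have ci0 : 0 <= c i by rewrite c_ge0// mem_head.
    have [l' hl'] := stable0_phase_scale alpha beta gamma delta (c i) alpha_gt0 gamma_gt0 ci0.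
    rewrite -/phase in hl'.
    exists (m' + l') => u; rewrite !big_cons hm' hl' (ger0_norm ci0); ring.
  exists (m - l) => u; rewrite hm hl kC; ring.
pose Y : {RV P >-> R} := k *: X i0 + (cst m : {mfun T >-> R}).
have hY w : Y w = k * X i0 w + m by [].
have charSY u : charfun S u = charfun Y u.
  rewrite (charfun_affine _ _ hY) (charfun_indep_sum _ _ _ indX _ _ _ us hS).
  rewrite stableX stable0_charfunE// -cexpD.
  under eq_bigr do rewrite stableX stable0_charfunE//.
  rewrite cexp_sum; congr cexp; apply/eqP; rewrite eq_complex Re_sum Im_sum /=.
  apply/andP; split; apply/eqP; last exact: hm.
  rewrite addr0 normrM (gtr0_norm k0) powRM ?(ltW k0)// kC mulrCA -mulrN.
  rewrite mulr_suml; apply: eq_bigr => i _.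
  by rewrite normrM powRM//; ring.
have q_affine p : 0 < p -> p < 1 -> quantile S p = k * quantile (X i0) p + m.
  move=> p0 plt1; apply: quantile_affine => // x.
  by rewrite (charfun_inj charSY) (cdf_affine _ _ k0 hY).
(* Positivity of the difference is what lets [ln] split the product with [k]. *)
have q_lt : quantile (X i0) p1 < quantile (X i0) p2.
  apply: quantile_lt => //; apply: charfun_cvg0_no_atom => eps eps0.
  have [U hU] := stable0_charfun_cvg0 alpha beta gamma delta alpha_gt0 gamma_gt0 _ eps0.
  by exists U => u /hU; rewrite -(stableX i0).
have p20 := lt_trans p10 p12; have p11 := lt_trans p12 p21.
rewrite /log_quantile_diff !q_affine// opprD addrACA subrr addr0 -mulrBr.
by rewrite lnM ?posrE ?subr_gt0// ln_powR.
Qed.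

End stable_sum.

Local Close Scope complex_scope.

(** * Moving averages *)

(* The coefficient of [e (t - k)] in the rolling sum [S_t^(r)]. *)
Definition ma_weight {R : realType} (q r : nat) (theta : nat -> R) (k : nat) : R :=
  \sum_(0 <= j < q.+1 | (j <= k < j + r)%N) theta j.

Section ma_weight.
Context {R : realType} (q r : nat) (theta : nat -> R).

(** Terms are collected by [k = i + j]: for fixed [j <= q], [k] runs over [j <= k < j + r], inside
    the range below [r + q]. *)
Lemma rolling_sum_ma_weight (E : nat -> R) :
  \sum_(0 <= i < r) \sum_(0 <= j < q.+1) theta j * E (i + j)%N =
  \sum_(0 <= k < r + q) ma_weight q r theta k * E k.
Proof.
under [RHS]eq_bigr do rewrite /ma_weight mulr_suml.
rewrite exchange_big [RHS](exchange_big_dep_nat xpredT)//=.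
apply: eq_big_nat => j /andP[_ jq]; rewrite -mulr_sumr -[RHS]mulr_sumr; congr (_ * _).
transitivity (\sum_(j <= k < j + r) E k).
  by rewrite [RHS](big_addn 0 (j + r) j) addKn.
rewrite (big_nat_widenl _ 0)// (big_nat_widen _ _ (r + q)); last lia.
by apply: eq_bigl => k; rewrite /= andbC.
Qed.

Lemma ma_weight0 : (0 < r)%N -> ma_weight q r theta 0 = theta 0%N.
Proof.
move=> r0; by rewrite /ma_weight big_mkcond big_nat_recl//= r0 big1 ?addr0.
Qed.

Hypothesis qr : (q <= r)%N.

Lemma ma_weight_lo k : (k < q)%N ->
  ma_weight q r theta k = \sum_(0 <= j < k.+1) theta j.
Proof.
move=> kq; rewrite (big_nat_widen _ _ q.+1); last lia.
by apply: congr_big_nat => // j /andP[_ jq]; lia.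
Qed.

Lemma ma_weight_mid k : (q <= k < r)%N ->
  ma_weight q r theta k = \sum_(0 <= j < q.+1) theta j.
Proof. by move=> kqr; apply: congr_big_nat => // j /andP[_ jq]; lia. Qed.

(** At [k = i + r - 1], [k < j + r] means [i <= j], and [j <= k] follows from [j <= q <= r <= k]. *)
Lemma ma_weight_hi i : (1 <= i <= q)%N ->
  ma_weight q r theta (i + r).-1 = \sum_(i <= j < q.+1) theta j.
Proof.
move=> iq; rewrite (big_nat_widenl _ 0)//.
by apply: congr_big_nat => // j /andP[_ jq]; lia.
Qed.

(** Cutting at [q] and [r] separates the three kinds of weights. The middle block has [r - q] equal
    terms, whence the summand with factor [- q] in [g_stable]. *)
Lemma sum_ma_weight alpha :
  \sum_(0 <= k < r + q) `|ma_weight q r theta k| `^ alpha =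
  r%:R * `|\sum_(0 <= i < q.+1) theta i| `^ alpha + g_stable alpha q theta.
Proof.
rewrite (@big_cat_nat _ _ _ q)//=; last lia.
rewrite (@big_cat_nat _ _ _ r q)//=; last lia.
rewrite (@eq_big_nat _ _ _ 0 q _ (fun i => `|\sum_(0 <= j < i.+1) theta j| `^ alpha)); last first.
  by move=> k /andP[_ kq]; rewrite ma_weight_lo.
have -> : \sum_(q <= k < r) `|ma_weight q r theta k| `^ alpha =
    (r%:R - q%:R) * `|\sum_(0 <= j < q.+1) theta j| `^ alpha.
  rewrite -natrB// mulr_natl -sumr_const_nat.
  by apply: eq_big_nat => k kqr; rewrite ma_weight_mid.
have -> : \sum_(r <= k < r + q) `|ma_weight q r theta k| `^ alpha =
    \sum_(1 <= i < q.+1) `|\sum_(i <= j < q.+1) theta j| `^ alpha.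
  rewrite (big_addn 0 (r + q) r) addKn big_add1 /=.
  apply: eq_big_nat => i /andP[_ iq].
  by rewrite -ma_weight_hi ?iq// addSn/=.
rewrite /g_stable; ring.
Qed.

End ma_weight.

Theorem theorem3 (R : realType) (d : measure_display) (T : measurableType d)
    (P : probability T R)
    (alpha beta gamma delta : R)
    (halpha : 0 < alpha <= 2) (hbeta : -1 <= beta <= 1) (hgamma : 0 < gamma)
    (q : nat) (theta : nat -> R) (htheta0 : theta 0%N = 1)
    (e : int -> {RV P >-> R}) (he_iid : iid e)
    (he_stable : forall t : int,
       has_stable0_law (e t) alpha beta gamma delta)
    (p1 p2 : R) (hp1 : 0 < p1) (hp12 : p1 < p2) (hp2 : p2 < 1)
    (hA : beta = 0 \/
      ((forall i : nat, (i < q)%N -> 0 <= \sum_(0 <= j < i.+1) theta j) /\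
       (forall i : nat, (1 <= i <= q)%N ->
          0 <= \sum_(i <= j < q.+1) theta j)))
    (r : nat) (hr1 : (1 <= r)%N) (hrq : (q <= r)%N) (t : int) :
  log_quantile_diff (rolling_sum (moving_average q theta e) r t) p1 p2 =
  alpha^-1 * ln (r%:R * `|\sum_(0 <= i < q.+1) theta i| `^ alpha
                 + g_stable alpha q theta)
  + log_quantile_diff (e t) p1 p2.
Proof.
have /andP[alpha0 _] := halpha; have [ind _] := he_iid.
pose s := [seq t - k%:Z | k <- index_iota 0 (r + q)].
(* On [s] the difference [t - i] is the natural number [k], so the absolute value only converts it
   to [nat]. *)
pose c i := ma_weight q r theta `|t - i|%N.
have ck (k : nat) : c (t - k%:Z) = ma_weight q r theta k.
  by rewrite /c opprB addrC subrK absz_nat.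
have us : uniq s.
  rewrite map_inj_uniq ?iota_uniq// => k l /addrI/oppr_inj; exact: (can_inj absz_nat).
have sum_s : \sum_(i <- s) `|c i| `^ alpha =
    r%:R * `|\sum_(0 <= i < q.+1) theta i| `^ alpha + g_stable alpha q theta.
  by rewrite big_map -sum_ma_weight//; apply: eq_bigr => k _; rewrite ck.
(* The full sum is [theta 0 = 1] plus the final sum from 1, which is empty when [q = 0]. *)
have theta_q : (forall i : nat, (1 <= i <= q)%N -> 0 <= \sum_(i <= j < q.+1) theta j) ->
    0 <= \sum_(0 <= j < q.+1) theta j.
  move=> h; rewrite big_ltn// htheta0 addr_ge0//.
  by have [->|q0] := posnP q; [rewrite big_geq|rewrite h// q0].
rewrite -sum_s; apply: (log_quantile_diff_stable_sum _ hgamma ind he_stable) => //.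
- move=> w; rewrite big_map.
  under [RHS]eq_bigr do rewrite ck.
  rewrite -(rolling_sum_ma_weight q r theta (fun k => e (t - k%:Z) w)).
  rewrite /rolling_sum mfun_sum; apply: eq_bigr => i _.
  rewrite /moving_average mfun_sum; apply: eq_bigr => j _.
  by rewrite /= PoszD opprD addrA.
(* The term [k = 0] alone contributes 1, so the argument of [ln] is positive even if the full sum of
   [theta] vanishes. *)
- rewrite big_map big_ltn ?addn_gt0 ?hr1// ck ma_weight0// htheta0.
  by rewrite normr1 powR1 ltr_wpDr// sumr_ge0// => k _; exact: powR_ge0.
- case: hA => [->|[h1 h2]]; [by left|right => _ /mapP[k + ->]].
  rewrite mem_index_iota ck => /andP[_ krq].
  have [kq|qk] := ltnP k q; first by rewrite ma_weight_lo// h1.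
  have [kr|rk] := ltnP k r; first by rewrite ma_weight_mid ?qk// theta_q.
  (* The weight at [k >= r] is the final sum starting at [k - r + 1]. *)
  rewrite (_ : k = ((k - r).+1 + r).-1)//; last lia.
  by rewrite ma_weight_hi ?h2//; lia.
Qed.
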